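(* Let $\mathbb{F}_q$ be a finite field of odd characteristic, and let $f_1,\ldots,f_r$ be a dynamically-irreducible set of (distinct) monic quadratic polynomials over $\mathbb{F}_q$, written as $f_j(X)=(X-b_j)^2+c_j$ with $b_j,c_j\in\mathbb{F}_q$. Suppose that all the $f_j$ have the same value of $c_j$, i.e. $c_1=\cdots=c_r$. Then $r\le 8q^{1/2}(\log q)^2$.
   Context: A set of polynomials $f_1,\ldots,f_r$ of positive degree over a finite field $\mathbb{F}_q$ is called dynamically-irreducible if all polynomials formed by composition of $f_1,\ldots,f_r$, i.e. all $f_{i_1}\circ f_{i_2}\circ\cdots\circ f_{i_n}$ with $n\ge 1$ and $i_1,\ldots,i_n\in\{1,\ldots,r\}$ (repetitions allowed), are irreducible over $\mathbb{F}_q$. Here $\log$ is the natural logarithm. *)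

(* Defs.v *)
From mathcomp Require Import all_boot all_order all_algebra.

Set Implicit Arguments.
Unset Strict Implicit.
Unset Printing Implicit Defensive.

Import GRing.Theory.
Local Open Scope ring_scope.

(* [:: i_1; ...; i_n] is sent to f i_1 \Po (f i_2 \Po (... \Po (f i_n \Po 'X))),
   i.e. f_{i_1} o ... o f_{i_n}, as p \Po q is p(q(X)). *)
Definition comp_word (F : fieldType) (I : Type) (f : I -> {poly F})
    (w : seq I) : {poly F} :=
  foldr (fun i g => f i \Po g) 'X w.

(* The empty word, of value 'X, is excluded.  Words of length 1 force every f i
   to be irreducible, hence of positive degree. *)
Definition dynamically_irreducible (F : finFieldType) (r : nat)
    (f : 'I_r -> {poly F}) : Prop :=
  forall w : seq 'I_r, (0 < size w)%N -> irreducible_poly (comp_word f w).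

(* Main.v *)
Require Import Defs.
From mathcomp Require Import all_boot all_order all_algebra.
From mathcomp Require Import cyclic finfield zify ring lra.
From mathcomp Require Import reals sequences exp.

Set Implicit Arguments.
Unset Strict Implicit.
Unset Printing Implicit Defensive.

Import Order.TTheory GRing.Theory Num.Theory.
Local Open Scope ring_scope.

(** Write q for the cardinal of F, chi for its quadratic character, c for the
    common value of the c_j and B for the set of the b_j, which has r elements.

    Irreducibility of f_i, and of f_i o f_j o f_k, forces -c and f_i(f_j(c)) to
    be nonsquares: if f_i(f_j(c)) is a square, then f_i o f_j o f_k factors
    explicitly, as a product of two norms from F(sqrt(-c))[X]
    ([irreducible_octic_nonsquare]).  Hence, with T = {f_j(c)}, every
    (x - t)^2 + c with x in B and t in T is a nonsquare; moreover #|B| <= 2 #|T|,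
    as each value (c - b)^2 + c is taken at most twice.

    The sum over all x in F of (sum_(t in T) chi((x - t)^2 + c))^2 is therefore
    at least #|B| #|T|^2.  Expanding the square, the diagonal contributes
    q #|T|, and an off-diagonal pair (s, t) contributes the character sum of the
    quartic ((X - s)^2 + c)((X - t)^2 + c), which is O(sqrt q).  So
    #|B| #|T|^2 <= q #|T| + O(sqrt q) #|T|^2, whence #|B| = O(sqrt q)
    ([second_moment_bound], [dynirr_card_bound]); this beats the claim as soon
    as q is at least 72^2, and r <= q suffices for smaller q.

    Only an upper bound for the quartic sums is needed, and it comes from
    Stepanov's method ([stepanov_bound]).  With n = (q-1)/2 there is a nonzero
    polynomial h = sum_(j < J) (r_j + s_j f^n) X^(j q), the r_j and s_j being of
    degree less than about q/2, which vanishes to order l, about 2 sqrt q, at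
    every x with f(x)^n = 1; comparing degrees bounds the number of these x by
    q/2 + O(sqrt q).  Existence of the coefficients is a dimension count
    ([stepanov_exists]).  That h is nonzero follows from f^(2n+1) = f^q being
    congruent to f(0) modulo X^q: a vanishing h would give r_0^2 f = f(0) s_0^2,
    and f is not a constant times a square ([stepanov_poly_eq0]). *)

(** * Squares in a finite field of odd order *)

(** Squares of F, 0 included. *)
Definition is_square (F : finFieldType) (x : F) : bool :=
  [exists y, x == y ^+ 2].

Lemma is_squareP (F : finFieldType) (x : F) :
  reflect (exists y, x = y ^+ 2) (is_square x).
Proof. by apply: (iffP existsP) => -[y /eqP]; exists y => //; apply/eqP. Qed.

Lemma card_pchar_pow (F : finFieldType) p :
  p \in [pchar F] -> #|F| = (p ^ logn p #|F|)%N.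
Proof. exact: card_pprimeChar. Qed.

Lemma odd_pchar_two_neq0 (F : finFieldType) p :
  p \in [pchar F] -> odd p -> 2 != 0 :> F.
Proof.
move=> pF oddp; rewrite -(dvdn_pcharf pF); apply/negP => /dvdn_leq-/(_ isT).
by case: p pF oddp => [|[|[|p]]] // /andP[].
Qed.

Lemma odd_pchar_odd_card (F : finFieldType) p :
  p \in [pchar F] -> odd p -> odd #|F|.
Proof. by move=> pF oddp; rewrite (card_pchar_pow pF) oddX oddp orbT. Qed.

(** Euler's criterion. *)
Lemma euler_criterion (F : finFieldType) (x : F) : odd #|F| -> x != 0 ->
  x ^+ #|F|.-1./2 = (if is_square x then 1 else -1).
Proof.
move=> oddq x0; set n := #|F|.-1./2.
have q1 : (1 < #|F|)%N := finNzRing_gt1 F.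
have nE : #|F|.-1 = (n * 2)%N by rewrite /n; lia.
have n0 : (0 < n)%N by lia.
have unit1 (y : F) : y != 0 -> y ^+ #|F|.-1 = 1.
  move=> y0; apply: (mulIf y0); rewrite -exprSr prednK ?mul1r ?expf_card //; lia.
(* z generates the multiplicative group; x = z^i with i even when z^(i n) = 1 *)
have [z zprim] : {z : F | #|F|.-1.-primitive_root z}.
  have : has #|F|.-1.-primitive_root (enum [set y : F | y != 0]).
    apply: has_prim_root; first lia.
    - apply/allP => y; rewrite mem_enum inE => /unit1 y1.
      by apply/unity_rootP.
    - exact: enum_uniq.
    - rewrite -cardE; have -> : [set y : F | y != 0] = ~: [set 0].
        by apply/setP => y; rewrite !inE.
      by rewrite cardsC1.
  by move=> /hasP/sig2W[w _ wP]; exists w.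
case: ifPn => [/is_squareP[y xE]|nsq].
  rewrite xE -exprM mulnC -nE unit1 //; apply: contraNneq x0 => y0.
  by rewrite xE y0 expr0n.
have [[i /= _] xE] := prim_rootP zprim (unit1 x x0).
have /eqP : (x ^+ n) ^+ 2 = 1 by rewrite -exprM -nE unit1.
rewrite -subr_eq0 subr_sqr_1 mulf_eq0 subr_eq0 addr_eq0 => /orP[|/eqP//].
rewrite xE /= -exprM -(prim_order_dvd zprim) nE (mulnC i) dvdn_pmul2l // => i2.
case/negP: nsq; apply/is_squareP; exists (z ^+ i./2).
by rewrite xE -exprM /=; congr (_ ^+ _); move: i2; lia.
Qed.

Lemma is_squareM (F : finFieldType) (x y : F) : odd #|F| -> x != 0 -> y != 0 ->
  is_square (x * y) = (is_square x == is_square y).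
Proof.
move=> oddq x0 y0; have xy0 : x * y != 0 by rewrite mulf_neq0.
have two0 : 1 != -1 :> F.
  have [p _ pF] := finPcharP F; rewrite -subr_eq0 opprK.
  apply: (odd_pchar_two_neq0 pF); move: oddq; rewrite (card_pchar_pow pF) oddX.
  by case/orP=> // /eqP l0; have := finNzRing_gt1 F; rewrite (card_pchar_pow pF) l0.
move: (euler_criterion oddq xy0); rewrite exprMn !euler_criterion //.
do 3!case: is_square => //; rewrite ?mulr1 ?mul1r ?mulrNN ?mulr1 => /eqP //;
  by rewrite ?(negPf two0) // eq_sym (negPf two0).
Qed.

(** * Factorisation over a quadratic extension *)

(** When -c is a nonsquare, an element x + y sqrt(-c) of the quadratic extension
    F(sqrt(-c)) whose norm x^2 + c y^2 is a square in F is itself a square,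
    namely (h.1 + h.2 sqrt(-c))^2. *)
Lemma quadext_sqrt (F : finFieldType) (c x y : F) :
  odd #|F| -> 2 != 0 :> F -> ~~ is_square (- c) -> is_square (x ^+ 2 + c * y ^+ 2) ->
  exists h : F * F, h.1 ^+ 2 - c * h.2 ^+ 2 = x /\ 2 * h.1 * h.2 = y.
Proof.
move=> oddq two0 nsq /is_squareP[n nE].
have c0 : c != 0.
  by apply: contraNneq nsq => ->; apply/is_squareP; exists 0; rewrite oppr0 expr0n.
have [y0|y0] := eqVneq y 0.
  have [->|x0] := eqVneq x 0; first by exists (0, 0); rewrite y0 /=; split; ring.
  have [/is_squareP[e ->]|xnsq] := boolP (is_square x).
    by exists (e, 0); rewrite y0 /=; split; ring.
  have : is_square (x * - c).
    by rewrite is_squareM ?oppr_eq0 // (negPf xnsq) (negPf nsq).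
  move=> /is_squareP[e eE]; exists (0, e / c); rewrite y0 /=; split; last by ring.
  by rewrite expr_div_n -eE; field.
(* the product of (x + n)/2 and (x - n)/2 is a nonsquare, so exactly one of
   them is a square, and it serves as h.1 ^+ 2 *)
have prodE : ((x + n) / 2) * ((x - n) / 2) = - c * (y / 2) ^+ 2.
  have -> : ((x + n) / 2) * ((x - n) / 2) = (x ^+ 2 - n ^+ 2) / 4.
    by field; rewrite two0 /= (_ : 4 = 2 * 2) ?mulf_neq0 //; ring.
  by rewrite -nE; field; rewrite two0 /= (_ : 4 = 2 * 2) ?mulf_neq0 //; ring.
have y20 : (y / 2) ^+ 2 != 0 by rewrite expf_neq0 // mulf_neq0 // invr_eq0.
have /andP[w0 w'0] : ((x + n) / 2 != 0) && ((x - n) / 2 != 0).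
  by rewrite -negb_or -mulf_eq0 prodE mulf_neq0 // oppr_eq0.
have half w w' : w + w' = x -> w * w' = - c * (y / 2) ^+ 2 -> w != 0 -> is_square w ->
    exists h : F * F, h.1 ^+ 2 - c * h.2 ^+ 2 = x /\ 2 * h.1 * h.2 = y.
  move=> wD wM wn0 /is_squareP[e eE].
  have e0 : e != 0 by apply: contraNneq wn0 => e0; rewrite eE e0 expr0n.
  exists (e, y / (2 * e)); split; rewrite /=; last by field; rewrite two0 e0.
  have -> : c * (y / (2 * e)) ^+ 2 = - (w * w') / e ^+ 2.
    by rewrite wM; field; rewrite two0 e0.
  by rewrite -wD -eE; field.
have : ~~ is_square (((x + n) / 2) * ((x - n) / 2)).
  have sqy : is_square ((y / 2) ^+ 2) by apply/is_squareP; exists (y / 2).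
  by rewrite prodE is_squareM ?oppr_eq0 // (negPf nsq) sqy.
rewrite is_squareM //.
have sumE : (x + n) / 2 + (x - n) / 2 = x by field.
have [sq1 _|nsq1] := boolP (is_square ((x + n) / 2)).
  exact: half sumE prodE w0 sq1.
have [sq2 _|//] := boolP (is_square ((x - n) / 2)).
by apply: half _ _ w'0 sq2; [rewrite addrC; exact: sumE | rewrite mulrC; exact: prodE].
Qed.

Lemma size_quadext_norm (F : fieldType) (c a0 a1 b0 b1 : F) :
  size (('X^2 + a1 *: 'X + a0%:P) ^+ 2 + c *: (b1 *: 'X + b0%:P) ^+ 2) = 5.
Proof.
have sB : (size (b1 *: 'X + b0%:P)%R <= 2)%N.
  rewrite (leq_trans (size_polyD _ _)) // geq_max.
  rewrite (leq_trans (size_scale_leq _ _)) ?size_polyX //.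
  by rewrite (leq_trans (size_polyC_leq1 _)).
have sl : (size (a1 *: 'X + a0%:P)%R < size ('X^2 : {poly F}))%N.
  rewrite size_polyXn ltnS (leq_trans (size_polyD _ _)) // geq_max.
  rewrite (leq_trans (size_scale_leq _ _)) ?size_polyX //.
  by rewrite (leq_trans (size_polyC_leq1 _)).
have sA : size ('X^2 + a1 *: 'X + a0%:P) = 3.
  by rewrite -addrA size_polyDl // size_polyXn.
have A0 : 'X^2 + a1 *: 'X + a0%:P != 0 by rewrite -size_poly_gt0 sA.
have sA2 : size (('X^2 + a1 *: 'X + a0%:P) ^+ 2) = 5 by rewrite expr2 size_mul // sA.
rewrite size_polyDl sA2 // (leq_ltn_trans (size_scale_leq _ _)) //.
rewrite (leq_ltn_trans (size_poly_exp_leq _ _)) //.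
by move: (size _) sB; lia.
Qed.

(** If A + B sqrt(-c) and A' + B' sqrt(-c) have product G - sqrt(-c), taking
    norms factors G^2 + c. *)
Lemma quadext_norm_reducible (F : fieldType) (c : F) (G : {poly F})
    (a0 a1 b0 b1 a0' a1' b0' b1' : F) :
  let A := 'X^2 + a1 *: 'X + a0%:P in let B := b1 *: 'X + b0%:P in
  let A' := 'X^2 + a1' *: 'X + a0'%:P in let B' := b1' *: 'X + b0'%:P in
  G = A * A' - c *: (B * B') -> A * B' + A' * B = -1 ->
  ~ irreducible_poly (G ^+ 2 + c%:P).
Proof.
move=> A B A' B' GE ABE irr.
have PE : G ^+ 2 + c%:P = (A ^+ 2 + c *: B ^+ 2) * (A' ^+ 2 + c *: B' ^+ 2).
  have -> : c%:P = c%:P * (A * B' + A' * B) ^+ 2 by rewrite ABE sqrrN expr1n mulr1.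
  by rewrite GE -!mul_polyC; ring.
have sN : size (A ^+ 2 + c *: B ^+ 2) = 5 by apply: size_quadext_norm.
have sN' : size (A' ^+ 2 + c *: B' ^+ 2) = 5 by apply: size_quadext_norm.
have dvd : A ^+ 2 + c *: B ^+ 2 %| G ^+ 2 + c%:P by rewrite PE dvdp_mulr.
have := irr.2 _ _ dvd; rewrite sN => /(_ isT) /eqp_size; rewrite PE.
by rewrite size_mul -?size_poly_gt0 ?sN ?sN'.
Qed.

(** If the octic (X^4 + u X^2 + v)^2 + c is irreducible, its constant term is a
    nonsquare.  Over F(sqrt(-c)) the
    polynomial X^4 + u X^2 + v - sqrt(-c) has a constant term of norm v^2 + c; if
    this is a square, the constant term is e^2 by [quadext_sqrt].  One of 2e - u,
    -2e - u and their product u^2 - 4 e^2 has square norm, and any of the three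
    being a square splits the quartic into two quadratics. *)
Lemma irreducible_octic_nonsquare (F : finFieldType) (c u v : F) :
  odd #|F| -> 2 != 0 :> F -> ~~ is_square (- c) ->
  irreducible_poly (('X^4 + u *: 'X^2 + v%:P) ^+ 2 + c%:P) ->
  ~~ is_square (v ^+ 2 + c).
Proof.
move=> oddq two0 nsq irr; apply/negP => sq.
have four0 : 4 != 0 :> F by rewrite (_ : 4 = 2 * 2) ?mulf_neq0 //; ring.
have [|[e0 e1] [/= eE1 eE2]] := quadext_sqrt (x := v) (y := -1) oddq two0 nsq.
  by rewrite sqrrN expr1n mulr1.
(* first two cases: X^4 + u X^2 + e^2 = (X^2 + e)^2 - (2 e - u) X^2 *)
have linear e0' e1' : e0' ^+ 2 - c * e1' ^+ 2 = v -> 2 * e0' * e1' = -1 ->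
   ~~ is_square ((2 * e0' - u) ^+ 2 + c * (2 * e1') ^+ 2).
  move=> E1 E2; apply/negP => /(quadext_sqrt oddq two0 nsq)[[h0 h1] /= [hE1 hE2]].
  apply: (@quadext_norm_reducible F c _ e0' h0 e1' h1 e0' (- h0) e1' (- h1)) irr.
    have -> : u = 2 * e0' - (h0 ^+ 2 - c * h1 ^+ 2) by rewrite hE1; ring.
    by rewrite -E1 -!mul_polyC; ring.
  rewrite -!mul_polyC (_ : -1 = (2 * e0' * e1')%:P + (2 * e1' - 2 * h0 * h1)%:P * 'X^2).
    by ring.
  by rewrite E2 hE2 subrr mul0r addr0 rmorphN.
have n1 := linear e0 e1 eE1 eE2.
have n2 : ~~ is_square ((2 * - e0 - u) ^+ 2 + c * (2 * - e1) ^+ 2).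
  by apply: linear; [rewrite -eE1; ring | rewrite -eE2; ring].
have nz x y : ~~ is_square (x ^+ 2 + c * y ^+ 2) -> x ^+ 2 + c * y ^+ 2 != 0.
  by apply: contraNneq => ->; apply/is_squareP; exists 0; rewrite expr0n.
(* last case: a square discriminant u^2 - 4 e^2, of imaginary part 4 *)
have : is_square (((2 * e0 - u) ^+ 2 + c * (2 * e1) ^+ 2) *
    ((2 * - e0 - u) ^+ 2 + c * (2 * - e1) ^+ 2)).
  by rewrite is_squareM ?nz // (negPf n1) (negPf n2).
have -> : ((2 * e0 - u) ^+ 2 + c * (2 * e1) ^+ 2) *
    ((2 * - e0 - u) ^+ 2 + c * (2 * - e1) ^+ 2) = (u ^+ 2 - 4 * v) ^+ 2 + c * 4 ^+ 2.
  have -> : 4 ^+ 2 = (4 * (2 * e0 * e1)) ^+ 2 :> F by rewrite eE2; ring.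
  by rewrite -eE1; ring.
move=> /(quadext_sqrt oddq two0 nsq)[[k0 k1] /= [kE1 kE2]].
apply: (@quadext_norm_reducible F c _ (u / 2 + k0 / 2) 0 (k1 / 2) 0
   (u / 2 - k0 / 2) 0 (- (k1 / 2)) 0) irr; rewrite !scale0r !addr0 !add0r -?mul_polyC.
  have -> : v = (u ^+ 2 - (k0 ^+ 2 - c * k1 ^+ 2)) / 4 by rewrite kE1; field.
  rewrite -[in LHS](divfK two0 u) -[in LHS](divfK two0 k0) -[in LHS](divfK two0 k1).
  set u' := u / 2; set k0' := k0 / 2; set k1' := k1 / 2.
  have -> : ((u' * 2) ^+ 2 - ((k0' * 2) ^+ 2 - c * (k1' * 2) ^+ 2)) / 4 =
      u' ^+ 2 - (k0' ^+ 2 - c * k1' ^+ 2) by field.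
  by ring.
have -> : -1 = - (k1 / 2 * k0)%:P :> {poly F}.
  have -> : k1 / 2 * k0 = 1; last by [].

  have -> : k1 / 2 * k0 = (2 * k0 * k1) / 4 by field; rewrite four0 two0.
  by rewrite kE2 divff.
have -> : k1 / 2 * k0 = k1 / 2 * (k0 / 2 + k0 / 2) by field.
by ring.
Qed.

(** * Rescaled Taylor expansions *)

(** The expansion p(X + f Y), a polynomial in the outer variable Y over F[X].
    Its coefficient in Y^k is f^k times the k-th Hasse derivative of p; the
    rescaling by f makes the expansion of a power of f divisible by that power. *)
Definition taylor (F : fieldType) (f p : {poly F}) : {poly {poly F}} :=
  map_poly polyC p \Po ('X%:P + f%:P * 'X).

Lemma taylorD (F : fieldType) (f p q : {poly F}) :
  taylor f (p + q) = taylor f p + taylor f q.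
Proof. by rewrite /taylor !rmorphD. Qed.

Lemma taylorB (F : fieldType) (f p q : {poly F}) :
  taylor f (p - q) = taylor f p - taylor f q.
Proof. by rewrite /taylor !rmorphB. Qed.

Lemma taylorM (F : fieldType) (f p q : {poly F}) :
  taylor f (p * q) = taylor f p * taylor f q.
Proof. by rewrite /taylor !rmorphM. Qed.

Lemma taylorC (F : fieldType) (f : {poly F}) (a : F) :
  taylor f a%:P = a%:P%:P.
Proof. by rewrite /taylor map_polyC /= comp_polyC. Qed.

Lemma taylorX (F : fieldType) (f : {poly F}) :
  taylor f 'X = 'X%:P + f%:P * 'X.
Proof. by rewrite /taylor map_polyX comp_polyX. Qed.

Lemma taylorXn (F : fieldType) (f p : {poly F}) n :
  taylor f (p ^+ n) = taylor f p ^+ n.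
Proof. by rewrite /taylor !rmorphXn. Qed.

Lemma taylor_sum (F : fieldType) (f : {poly F}) n (G : 'I_n -> {poly F}) :
  taylor f (\sum_(i < n) G i) = \sum_(i < n) taylor f (G i).
Proof. by rewrite /taylor !rmorph_sum. Qed.

(** Q is a polynomial in Y whose coefficient in Y^k has degree at most d + e k. *)
Definition weight_le (F : fieldType) (e d : nat) (Q : {poly {poly F}}) : Prop :=
  forall k, (size (Q`_k)%R <= d + e * k + 1)%N.

Lemma weight_le_trans (F : fieldType) e d d' (Q : {poly {poly F}}) :
  (d <= d')%N -> weight_le e d Q -> weight_le e d' Q.
Proof. by move=> dd' QW k; rewrite (leq_trans (QW k)) // !leq_add2r. Qed.

Lemma weight_leD (F : fieldType) e d (P Q : {poly {poly F}}) :
  weight_le e d P -> weight_le e d Q -> weight_le e d (P + Q).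
Proof.
by move=> PW QW k; rewrite coefD (leq_trans (size_polyD _ _)) // geq_max PW QW.
Qed.

Lemma weight_le_sum (F : fieldType) e d n (G : 'I_n -> {poly {poly F}}) :
  (forall i, weight_le e d (G i)) -> weight_le e d (\sum_(i < n) G i).
Proof.
move=> GW k; rewrite coef_sum; apply: (leq_trans (size_sum _ _ _)).
by apply/bigmax_leqP => i _; apply: GW.
Qed.

Lemma weight_leM (F : fieldType) e d d' (P Q : {poly {poly F}}) :
  weight_le e d P -> weight_le e d' Q -> weight_le e (d + d') (P * Q).
Proof.
move=> PW QW k; rewrite coefM; apply: (leq_trans (size_sum _ _ _)).
apply/bigmax_leqP => i _; apply: (leq_trans (size_polyMleq _ _)).
move: (PW i) (QW (k - i)%N) (ltn_ord i).
have -> : (e * k = e * i + e * (k - i))%N by rewrite -mulnDr subnKC // -ltnS.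
by lia.
Qed.

Lemma weight_leC (F : fieldType) e (p : {poly F}) :
  weight_le e (size p).-1 (p%:P).
Proof. by move=> k; rewrite coefC; case: eqP => _; rewrite ?size_poly0 //; lia. Qed.

Lemma weight_le1 (F : fieldType) e : weight_le e 0 (1 : {poly {poly F}}).
Proof. by apply: weight_le_trans (weight_leC e 1); rewrite size_poly1. Qed.

Lemma weight_leXn (F : fieldType) e d n (P : {poly {poly F}}) :
  weight_le e d P -> weight_le e (n * d) (P ^+ n).
Proof.
move=> PW; elim: n => [|n IH]; first exact: weight_le1.
by rewrite exprS mulSn; apply: weight_leM.
Qed.

Lemma weight_le_taylor (F : fieldType) e (f p : {poly F}) :
  (size f <= e.+2)%N -> weight_le e (size p).-1 (taylor f p).
Proof.
move=> sf; rewrite -{2}[p]coefK poly_def taylor_sum; apply: weight_le_sum => i.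
rewrite -mul_polyC taylorM taylorC taylorXn taylorX.
have WX : weight_le e 1 ('X%:P + f%:P * 'X).
  move=> k; rewrite coefD coefC coefMX coefC.
  case: k => [|[|k]]; rewrite /= ?addr0 ?add0r ?size_poly0 ?size_polyX //; first lia.
  by apply: (leq_trans sf); lia.
apply: (@weight_le_trans _ _ (0 + i * 1)%N); first by have := ltn_ord i; lia.
apply: weight_leM; last exact: weight_leXn.
by apply: weight_le_trans (weight_leC e _); have := size_polyC_leq1 p`_i; lia.
Qed.

Lemma taylor_cong (F : fieldType) (f p : {poly F}) :
  exists V, taylor f p = p%:P + f%:P * V.
Proof.
elim/poly_ind: p => [|p a [V VE]].
  exists 0.
  by rewrite /taylor !rmorph0 mulr0 addr0.
exists (p%:P * 'X + V * ('X%:P + f%:P * 'X)).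
by rewrite taylorD taylorM taylorX taylorC VE rmorphD rmorphM /=; ring.
Qed.

(** In the expansion of f itself f factors out, and the degrees of the cofactor
    grow no faster than those of an expansion. *)
Lemma taylor_self (F : fieldType) e (f : {poly F}) : size f = e.+2 ->
  exists2 U, taylor f f = f%:P * U & weight_le e 0 U.
Proof.
move=> sf; have [V VE] := taylor_cong f f.
have fUE : taylor f f = f%:P * (1 + V) by rewrite VE; ring.
exists (1 + V) => // k.
have := weight_le_taylor f (eq_leq sf) k; rewrite sf fUE coefCM.
have [->|U0] := eqVneq (1 + V)`_k 0; first by rewrite size_poly0.
have f0 : f != 0 by rewrite -size_poly_gt0 sf.
have -> : size (f * (1 + V)`_k) = (e.+1 + size ((1 + V)`_k)%R)%N.
  by rewrite size_mul // sf.
by move: (size _) => n; lia.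
Qed.

Lemma horner_taylor (F : fieldType) (f p : {poly F}) (x : F) :
  map_poly (horner_eval x) (taylor f p) = p \Po (x%:P + f.[x] *: 'X).
Proof.
rewrite /taylor map_comp_poly -map_poly_comp /=.
rewrite rmorphD rmorphM /= !map_polyC map_polyX /= /horner_eval hornerX mul_polyC.
by congr (_ \Po _); rewrite map_poly_id // => a _ /=; rewrite hornerC.
Qed.

Lemma dvdp_Xn_coef (F : fieldType) (p : {poly F}) n :
  (forall k, (k < n)%N -> p`_k = 0) -> 'X^n %| p.
Proof.
move=> p0; rewrite -(poly_take_drop n p).
have -> : take_poly n p = 0.
  by apply/polyP => k; rewrite coef_take_poly coef0; case: ifP => // /p0.
by rewrite add0r dvdp_mull.
Qed.

(** The order of vanishing of p at a point x outside the zeros of f is read off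
    the expansion of p at X = x. *)
Lemma dvdp_taylor (F : fieldType) (f p : {poly F}) (x : F) l :
  f.[x] != 0 -> 'X^l %| map_poly (horner_eval x) (taylor f p) ->
  ('X - x%:P) ^+ l %| p.
Proof.
rewrite horner_taylor => fx0 /dvdpP[w wE].
apply/dvdpP; exists (f.[x] ^- l *: (w \Po (f.[x]^-1 *: ('X - x%:P)))).
have := congr1 (comp_poly (f.[x]^-1 *: ('X - x%:P))) wE.
rewrite -comp_polyA comp_polyD comp_polyC comp_polyZ comp_polyX scalerA divff //.
rewrite scale1r addrC subrK comp_polyXr comp_polyM => ->.
by rewrite rmorphXn /= comp_polyX exprZn exprVn -scalerAr -scalerAl.
Qed.

(** * Stepanov's method *)

(** With [exprDn_pchar], this makes p |-> p^q additive on F[X]. *)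
Lemma pnat_card_pchar_poly (F : finFieldType) : [pchar {poly F}].-nat #|F|.
Proof.
have [p _ pF] := finPcharP F; rewrite (card_pchar_pow pF).
have pP : p \in [pchar {poly F}] by rewrite pchar_poly.
by rewrite pnatX pnatE ?(pcharf_prime pF) // pP.
Qed.

Lemma size_polyM_le (F : fieldType) (p q : {poly F}) a b :
  (size p <= a)%N -> (size q <= b)%N -> (size (p * q)%R <= (a + b).-1)%N.
Proof.
move=> pa qb; apply: (leq_trans (size_polyMleq _ _)).
by rewrite -!subn1 leq_sub2r // leq_add.
Qed.

(** The auxiliary polynomial, for families r and s of polynomials of which only
    the first J terms matter. *)
Definition stepanov_poly (F : finFieldType) (f : {poly F}) n J
    (r s : nat -> {poly F}) : {poly F} :=
  \sum_(j < J) (r j + s j * f ^+ n) * 'X^(j * #|F|).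

(** The polynomial in Y whose first l coefficients have to vanish for
    [stepanov_poly] to vanish to order l at every x with f(x)^n = 1.  It arises
    from the expansion of [stepanov_poly] by replacing X^q, which is congruent to
    x modulo (X - x)^q, by X, and the factor f^n by 1. *)
Definition stepanov_cond (F : fieldType) (f : {poly F}) (U : {poly {poly F}}) n J
    (r s : nat -> {poly F}) : {poly {poly F}} :=
  \sum_(j < J) ('X^j)%:P * (taylor f (r j) + taylor f (s j) * U ^+ n).

Lemma stepanov_condB (F : fieldType) (f : {poly F}) U n J
    (r r' s s' : nat -> {poly F}) :
  stepanov_cond f U n J (fun j => r j - r' j) (fun j => s j - s' j) =
  stepanov_cond f U n J r s - stepanov_cond f U n J r' s'.
Proof.
rewrite /stepanov_cond -sumrB; apply: eq_bigr => j _.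
by rewrite !taylorB mulrBl -mulrBr opprD addrACA.
Qed.

Lemma weight_le_stepanov_cond (F : fieldType) e D (f : {poly F}) U n J
    (r s : nat -> {poly F}) :
  (size f <= e.+2)%N -> weight_le e 0 U ->
  (forall j, (size (r j) <= D)%N) -> (forall j, (size (s j) <= D)%N) ->
  weight_le e (J.-1 + D.-1) (stepanov_cond f U n J r s).
Proof.
move=> sf UW rD sD; apply: weight_le_sum => j; apply: weight_leM.
  apply: weight_le_trans (weight_leC _ _); rewrite size_polyXn /=.
  by have := ltn_ord j; lia.
have dW (p : {poly F}) : (size p <= D)%N -> weight_le e D.-1 (taylor f p).
  by move=> pD; apply: weight_le_trans (weight_le_taylor _ sf); lia.
apply: weight_leD; first exact: dW.
rewrite -[D.-1]addn0 -[X in (_ + X)%N](muln0 n).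
by apply: weight_leM; [exact: dW | exact: weight_leXn].
Qed.

Lemma stepanov_poly_vanish (F : finFieldType) (f : {poly F}) U n J
    (r s : nat -> {poly F}) x l :
  taylor f f = f%:P * U -> f.[x] != 0 -> f.[x] ^+ n = 1 -> (l <= #|F|)%N ->
  (forall k, (k < l)%N -> (stepanov_cond f U n J r s)`_k = 0) ->
  ('X - x%:P) ^+ l %| stepanov_poly f n J r s.
Proof.
move=> fU fx0 fxn lq cond0.
(* h is congruent to H modulo X^q - x, which is (X - x)^q *)
pose H := \sum_(j < J) (x ^+ j)%:P * (r j + s j * f ^+ n).
have dH : ('X - x%:P) ^+ l %| H.
  apply: (dvdp_taylor fx0).
  have -> : map_poly (horner_eval x) (taylor f H) =
      map_poly (horner_eval x) (stepanov_cond f U n J r s).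
    rewrite /H taylor_sum !rmorph_sum; apply: eq_bigr => j _ /=.
    rewrite taylorM taylorD taylorM taylorXn taylorC fU exprMn.
    rewrite !(rmorphM, rmorphD, rmorphXn) /= !map_polyC /= /horner_eval.
    by rewrite hornerC hornerX -[(f.[x])%:P ^+ n]polyC_exp fxn mul1r.
  apply: dvdp_Xn_coef => k kl; rewrite coef_map /= cond0 //.
  by rewrite /horner_eval horner0.
have -> : stepanov_poly f n J r s =
   \sum_(j < J) (r j + s j * f ^+ n) * ('X^(j * #|F|) - (x ^+ j)%:P) + H.
  by rewrite -big_split /=; apply: eq_bigr => j _; ring.
rewrite dvdp_addl //; elim/big_ind: _ => [|p q dp dq|j _]; rewrite ?dvdp0 ?dvdp_add //.
apply: dvdp_mull; apply: (dvdp_trans (dvdp_exp2l _ lq)).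
have -> : ('X - x%:P) ^+ #|F| = 'X^#|F| - x%:P.
  have := exprDn_pchar ('X - x%:P) x%:P (pnat_card_pchar_poly F).
  by rewrite subrK -polyC_exp expf_card => ->; ring.
by rewrite mulnC exprM polyC_exp subrXX dvdp_mulr.
Qed.

(** Modulo X^q, the power f^(2n+1) is the constant f(0), so that
    r + s f^n = 0 implies r^2 f = f(0) s^2; as both sides have degree less than
    q, this is an equality of polynomials. *)
Lemma stepanov_step (F : finFieldType) (f r s : {poly F}) e D n :
  size f = e.+2 -> f`_0 != 0 -> #|F| = n.*2.+1 -> (D.*2 + e <= #|F|)%N ->
  (forall r s : {poly F}, r ^+ 2 * f = f`_0 *: s ^+ 2 -> r = 0) ->
  (size r <= D)%N -> (size s <= D)%N ->
  'X^#|F| %| r + s * f ^+ n -> r = 0 /\ s = 0.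
Proof.
move=> sf f00 qE Dq nsq rD sD dv.
have key : r ^+ 2 * f = f`_0 *: s ^+ 2.
  apply/eqP; rewrite -subr_eq0; apply/eqP.
  apply: contraTeq isT => nz.
  have : 'X^#|F| %| r ^+ 2 * f - f`_0 *: s ^+ 2.
    have -> : r ^+ 2 * f - f`_0 *: s ^+ 2 = (r + s * f ^+ n) * (r - s * f ^+ n) * f
        + s ^+ 2 * (f ^+ #|F| - (f`_0)%:P).
      have -> : f ^+ #|F| = f * (f ^+ n) ^+ 2 by rewrite qE exprS -muln2 exprM.
      by rewrite -mul_polyC; ring.
    rewrite dvdp_add //; first by rewrite -mulrA dvdp_mulr.
    have -> : f ^+ #|F| - (f`_0)%:P = (f - (f`_0)%:P) ^+ #|F|.
      have := exprDn_pchar (f - (f`_0)%:P) (f`_0)%:P (pnat_card_pchar_poly F).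
      by rewrite subrK -polyC_exp expf_card => ->; ring.
    apply: dvdp_mull; apply: dvdp_exp2r; rewrite -['X]expr1.
    apply: dvdp_Xn_coef => -[|//] _.
    by rewrite coefB coefC subrr.
  move=> /(dvdp_leq nz); rewrite size_polyXn leqNgt => /negP[].
  rewrite ltnS (leq_trans (size_polyD _ _)) // geq_max size_polyN; apply/andP; split.
    case: (D) rD Dq => [|D'] rD Dq.
      move: rD; rewrite leqn0 size_poly_eq0 => /eqP ->.
      by rewrite expr0n mul0r size_poly0.
    apply: (leq_trans (size_polyM_le (size_polyM_le rD rD) (eq_leq sf))).
    by move: Dq; lia.
  apply: (leq_trans (size_scale_leq _ _)); rewrite expr2.
  by apply: (leq_trans (size_polyM_le sD sD)); move: Dq; lia.
have r0 := nsq _ _ key; split=> //; apply/eqP.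
move/eqP: key; rewrite r0 expr0n mul0r eq_sym scaler_eq0 (negPf f00) /=.
by rewrite expf_eq0.
Qed.

(** The terms of the auxiliary polynomial are independent: the lowest one vanishes
    modulo X^q, hence is 0, and X^q can be divided out. *)
Lemma stepanov_poly_eq0 (F : finFieldType) (f : {poly F}) e D n J
    (r s : nat -> {poly F}) :
  size f = e.+2 -> f`_0 != 0 -> #|F| = n.*2.+1 -> (D.*2 + e <= #|F|)%N ->
  (forall r s : {poly F}, r ^+ 2 * f = f`_0 *: s ^+ 2 -> r = 0) ->
  (forall j, (size (r j) <= D)%N) -> (forall j, (size (s j) <= D)%N) ->
  stepanov_poly f n J r s = 0 ->
  forall j, (j < J)%N -> r j = 0 /\ s j = 0.
Proof.
move=> sf f00 qE Dq nsq; elim: J r s => [//|J IH] r s rD sD.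
rewrite /stepanov_poly big_ord_recl mul0n mulr1.
have -> : \sum_(i < J) (r (lift ord0 i) + s (lift ord0 i) * f ^+ n) *
    'X^(lift ord0 i * #|F|) =
    stepanov_poly f n J (fun j => r j.+1) (fun j => s j.+1) * 'X^#|F|.
  rewrite mulr_suml; apply: eq_bigr => i _.
  by rewrite lift0 mulSn addnC exprD mulrA.
move=> h0; have [r0 s0] : r 0 = 0 /\ s 0 = 0.
  apply: (stepanov_step sf f00 qE Dq nsq (rD _) (sD _)).
  by move: (dvdp0 ('X^#|F| : {poly F})); rewrite -{1}h0 dvdp_addl // dvdp_mull.
move: h0; rewrite r0 s0 mul0r !add0r => /eqP.
rewrite mulf_eq0 (negPf (monic_neq0 (monicXn _ _))) orbF => /eqP h0 [|j] //.
by move=> jJ; apply: (IH (fun j => r j.+1) (fun j => s j.+1)).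
Qed.

Lemma size_stepanov_poly (F : finFieldType) (f : {poly F}) e D n J
    (r s : nat -> {poly F}) :
  (size f <= e.+2)%N ->
  (forall j, (size (r j) <= D)%N) -> (forall j, (size (s j) <= D)%N) ->
  (size (stepanov_poly f n J r s) <= D + e.+1 * n + J.-1 * #|F|)%N.
Proof.
move=> sf rD sD; apply: (leq_trans (size_sum _ _ _)).
apply/bigmax_leqP => j _; apply: (leq_trans (size_polyMleq _ _)).
rewrite size_polyXn addnS /=; apply: leq_add; last first.
  by rewrite leq_mul2r -ltnS (leq_trans (ltn_ord j) (leqSpred _)) orbT.
apply: (leq_trans (size_polyD _ _)); rewrite geq_max; apply/andP; split.
  exact: leq_trans (rD _) (leq_addr _ _).
have sfn : (size (f ^+ n)%R <= (e.+1 * n).+1)%N.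
  apply: (leq_trans (size_poly_exp_leq _ _)); rewrite ltnS leq_mul2r.
  by rewrite -[e.+1]/(e.+2.-1) -!subn1 leq_sub2r ?orbT.
by apply: (leq_trans (size_polyM_le (sD j) sfn)); lia.
Qed.

Lemma pigeonhole (U V : finType) (phi : U -> V) : (#|V| < #|U|)%N ->
  exists u v, u != v /\ phi u = phi v.
Proof.
move=> VU; have : ~~ injectiveb phi.
  by apply/negP => /injectiveP/leq_card; rewrite leqNgt VU.
by case/injectivePn => u [v uv phiE]; exists u, v.
Qed.

Lemma card_high_roots (F : finFieldType) (h : {poly F}) (A : {set F}) l :
  h != 0 -> (forall x, x \in A -> ('X - x%:P) ^+ l %| h) ->
  (#|A| * l < size h)%N.
Proof.
move=> h0 dvd.
have : \prod_(x <- enum A) ('X - x%:P) ^+ l %| h.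
  have : forall x, x \in enum A -> ('X - x%:P) ^+ l %| h.
    by move=> x; rewrite mem_enum; apply: dvd.
  elim: (enum A) (enum_uniq A) => [|x t IH] /=; first by rewrite big_nil dvd1p.
  move=> /andP[xt ut] dv; rewrite big_cons Gauss_dvdp.
    by rewrite dv ?mem_head // IH // => y yt; rewrite dv // in_cons yt orbT.
  rewrite coprimep_expl // coprimep_sym big_seq.
  elim/big_ind: _ => [|p q cp cq|y yt]; first exact: coprime1p.
    by rewrite coprimepMl cp.
  rewrite coprimep_expl // coprimep_XsubC root_XsubC.
  by apply: contraNneq xt => ->.
move=> /(dvdp_leq h0); apply: leq_trans; rewrite prodrXl.
have nz : \prod_(x <- enum A) ('X - x%:P) != 0.
  exact: monic_neq0 (monic_prod_XsubC _ _ _).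
have := size_exp (\prod_(x <- enum A) ('X - x%:P)) l.
rewrite size_prod_XsubC /= -cardE => <-.
by rewrite prednK // size_poly_gt0 expf_neq0.
Qed.

(** The left side of the inequality bounds the number of linear conditions, the
    right side is the number of unknown coefficients. *)
Lemma stepanov_exists (F : finFieldType) (f : {poly F}) U e n D J l :
  size f = e.+2 -> weight_le e 0 U -> (0 < J)%N ->
  (l * (J + D + e * l) < 2 * J * D)%N ->
  exists r s : nat -> {poly F},
    [/\ forall j, (size (r j) <= D)%N, forall j, (size (s j) <= D)%N,
        exists2 j, (j < J)%N & r j != 0 \/ s j != 0 &
        forall k, (k < l)%N -> (stepanov_cond f U n J r s)`_k = 0].
Proof.
case: J => // J sf UW _ ineq; set E := (J.+1 + D + e * l)%N in ineq.
pose T := 'M[F]_(J.+1, D).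
pose pol (u : T) (j : nat) : {poly F} := rVpoly (row (inord j) u).
pose C (u : T * T) := stepanov_cond f U n J.+1 (pol u.1) (pol u.2).
pose phi (u : T * T) := \matrix_(k < l, i < E) (C u)`_k`_i.
have phiCE u k i : phi u k i = (C u)`_k`_i by rewrite mxE.
clearbody phi; have polD u v j : (size (pol u j - pol v j)%R <= D)%N.
  by rewrite (leq_trans (size_polyD _ _)) // geq_max size_polyN !size_poly.
have pol_inj (u v : T) : u != v -> exists2 j, (j < J.+1)%N & pol u j - pol v j != 0.
  move=> uv; have [j rowj] : exists j, row j u != row j v.
    apply/existsP; apply: contraNT uv; rewrite negb_exists => /forallP uv.
    by apply/eqP/row_matrixP => j; apply/eqP; have := uv j; rewrite negbK.
  exists (j : nat); first exact: ltn_ord.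
  rewrite subr_eq0; apply: contraNneq rowj; rewrite /pol inord_val => uvj.
  by rewrite -[row j u]rVpolyK -[row j v]rVpolyK uvj.
have [|[u1 u2] [[v1 v2] [uv phiE]]] := @pigeonhole _ _ phi.
  by rewrite card_prod !card_mx -expnD ltn_exp2l ?finNzRing_gt1 //; lia.
exists (fun j => pol u1 j - pol v1 j), (fun j => pol u2 j - pol v2 j); split.
- exact: polD.
- exact: polD.
- have [u1v1|] := eqVneq u1 v1; last by move=> /pol_inj[j jJ nz]; exists j; [|left].
  have : u2 != v2 by apply: contraNneq uv => ->; rewrite u1v1.
  by move=> /pol_inj[j jJ nz]; exists j; [|right].
move=> k kl; apply/polyP => i; rewrite coef0.
have [iE|iE] := ltnP i E.
  rewrite stepanov_condB !coefB.
  apply/eqP; rewrite subr_eq0; apply/eqP.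
  by have /matrixP/(_ (Ordinal kl) (Ordinal iE)) := phiE; rewrite !phiCE.
apply: nth_default; apply: leq_trans iE.
have Ck := weight_le_stepanov_cond n J.+1 (eq_leq sf) UW (polD u1 v1) (polD u2 v2) k.
apply: (leq_trans Ck).
rewrite /E /=; have : (e * k <= e * l)%N by rewrite leq_mul2l ltnW ?orbT.
by move: (e * k)%N (e * l)%N; lia.
Qed.

(** Stepanov's bound, for n = (q-1)/2 and f of degree e + 1 without zeros in F
    that is not f(0) times a square, even of a rational function. *)
Lemma stepanov_bound (F : finFieldType) (f : {poly F}) e n D J l :
  size f = e.+2 -> #|F| = n.*2.+1 -> (forall x, f.[x] != 0) ->
  (forall r s : {poly F}, r ^+ 2 * f = f`_0 *: s ^+ 2 -> r = 0) ->
  (D.*2 + e <= #|F|)%N -> (l <= #|F|)%N -> (0 < J)%N ->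
  (l * (J + D + e * l) < 2 * J * D)%N ->
  (#|[set x | (f.[x] ^+ n == 1)%R]| * l < D + e.+1 * n + J.-1 * #|F|)%N.
Proof.
move=> sf qE fx0 nsq Dq lq J0 ineq.
have f00 : f`_0 != 0 by rewrite -horner_coef0.
have [U fU UW] := taylor_self sf.
have [r [s [rD sD [j jJ nz] cond0]]] := stepanov_exists n sf UW J0 ineq.
have h0 : stepanov_poly f n J r s != 0.
  apply/eqP => /(stepanov_poly_eq0 sf f00 qE Dq nsq rD sD)/(_ j jJ)[r0 s0].
  by case: nz; rewrite ?r0 ?s0 eqxx.
apply: leq_trans (size_stepanov_poly n J (eq_leq sf) rD sD).
apply: card_high_roots h0 _ => x; rewrite inE => /eqP fxn.
exact: stepanov_poly_vanish fU (fx0 x) fxn lq cond0.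
Qed.

(** * Correlations of two quadratics *)

Lemma irreducible_coprimep (F : fieldType) (p q : {poly F}) :
  irreducible_poly p -> ~~ (p %| q) -> coprimep p q.
Proof.
move=> [_ irr] ndv; rewrite /coprimep; apply: contraNT ndv => sg.
by rewrite -(eqp_dvdl _ (irr _ sg (dvdp_gcdl p q))) dvdp_gcdr.
Qed.

Lemma irreducible_dvdp_sqr (F : fieldType) (p q : {poly F}) :
  irreducible_poly p -> p %| q ^+ 2 -> p %| q.
Proof.
move=> irr; apply: contraTT => /(irreducible_coprimep irr) cop.
rewrite -[q ^+ 2]mulr1 Gauss_dvdpr ?coprimep_expr // dvdp1.
by case: irr => sp _; rewrite gtn_eqF.
Qed.

(** Infinite descent: p divides s, then r, and can be cancelled from both. *)
Lemma irreducible_sqfree_mul (F : fieldType) (p g : {poly F}) (k : F) :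
  irreducible_poly p -> coprimep p g -> k != 0 ->
  forall r s : {poly F}, r ^+ 2 * (p * g) = k *: s ^+ 2 -> r = 0.
Proof.
move=> irr cop k0 r; have p0 := irredp_neq0 irr.
have [n] := ubnP (size r); elim: n r => // n IH r /ltnSE rn s rsE.
have /dvdpP[s' sE] : p %| s.
  apply: (irreducible_dvdp_sqr irr).
  by rewrite -(dvdpZr _ _ k0) -rsE mulrCA dvdp_mulr.
have rsE' : r ^+ 2 * g = k *: (p * s' ^+ 2).
  by apply: (mulfI p0); move: rsE; rewrite sE -!mul_polyC => rsE; ring: rsE.
have /dvdpP[r' rE] : p %| r.
  apply: (irreducible_dvdp_sqr irr); rewrite -(Gauss_dvdpl _ cop) rsE'.
  by rewrite dvdpZr // dvdp_mulr.
have [r'0|r'0] := eqVneq r' 0; first by rewrite rE r'0 mul0r.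
have rsE'' : r' ^+ 2 * (p * g) = k *: s' ^+ 2.
  by apply: (mulfI p0); move: rsE'; rewrite rE -!mul_polyC => rsE'; ring: rsE'.
suff: (size r' < n)%N by move=> r'n; rewrite rE (IH r' r'n _ rsE'') mul0r.
apply: leq_trans rn; rewrite rE size_mul //; case: irr => sp _.
have : (0 < size r')%N by rewrite size_poly_gt0.
by move: sp; move: (size p) (size r'); lia.
Qed.

(** The quadratics of the family, with fixed c. *)
Definition quad (F : fieldType) (c t : F) : {poly F} := ('X - t%:P) ^+ 2 + c%:P.

Lemma horner_quad (F : fieldType) (c t x : F) : (quad c t).[x] = (x - t) ^+ 2 + c.
Proof. by rewrite /quad !hornerE. Qed.

Lemma size_quad (F : fieldType) (c t : F) : size (quad c t) = 3.
Proof.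
by rewrite size_polyDl size_exp_XsubC // (leq_ltn_trans (size_polyC_leq1 _)).
Qed.

Lemma horner_quad_neq0 (F : finFieldType) (c t x : F) : ~~ is_square (- c) ->
  (quad c t).[x] != 0.
Proof.
rewrite horner_quad; apply: contraNneq => e; apply/is_squareP; exists (x - t).
by apply/eqP; rewrite eq_sym -addr_eq0 e.
Qed.

Lemma irreducible_quad (F : finFieldType) (c t : F) : ~~ is_square (- c) ->
  irreducible_poly (quad c t).
Proof.
move=> nsq; apply: cubic_irreducible; rewrite ?size_quad // => x.
exact: horner_quad_neq0.
Qed.

Lemma coprimep_quad (F : finFieldType) (c s t : F) : 2 != 0 :> F ->
  ~~ is_square (- c) -> s != t -> coprimep (quad c s) (quad c t).
Proof.
move=> two0 nsq st; apply: irreducible_coprimep; first exact: irreducible_quad.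
apply: contra st => dv.
have : quad c s %| (quad c t - quad c s).
  by rewrite dvdp_sub.
have -> : quad c t - quad c s = (2 * (s - t)) *: 'X + (t ^+ 2 - s ^+ 2)%:P.
  by rewrite /quad -mul_polyC; ring.
have [d0|d0] := eqVneq (2 * (s - t)) 0.
  by move: d0 => /eqP; rewrite mulf_eq0 (negPf two0) subr_eq0.
have sl : size ((2 * (s - t)) *: 'X + (t ^+ 2 - s ^+ 2)%:P) = 2.
  rewrite size_polyDl size_scale // size_polyX //.
  by rewrite (leq_ltn_trans (size_polyC_leq1 _)).
have nz : (2 * (s - t)) *: 'X + (t ^+ 2 - s ^+ 2)%:P != 0 by rewrite -size_poly_gt0 sl.
by move=> /(dvdp_leq nz); rewrite sl size_quad.
Qed.

(** The correlation bound: for a with a^2 at most q, the number of x at which the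
    quartic takes a square value is at most q/2 + (35/4) q/a. *)
Lemma quad_pair_bound (F : finFieldType) (a : nat) (c s t : F) :
  odd #|F| -> 2 != 0 :> F -> ~~ is_square (- c) -> s != t ->
  (18 <= a)%N -> (a ^ 2 <= #|F|)%N ->
  (4 * a * #|[set x | is_square ((quad c s * quad c t).[x])]| <=
    2 * a * #|F| + 35 * #|F|)%N.
Proof.
move=> oddq two0 nsq st a18 aq; set f := quad c s * quad c t.
have fx0 x : f.[x] != 0 by rewrite hornerM mulf_neq0 // horner_quad_neq0.
have sf : size f = 5.
  by rewrite size_mul ?size_quad // -size_poly_gt0 size_quad.
have qE : #|F| = (#|F|.-1./2).*2.+1.
  by move: oddq; move: #|F|; lia.
have nsqf (r s' : {poly F}) : r ^+ 2 * f = f`_0 *: s' ^+ 2 -> r = 0.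
  apply: (irreducible_sqfree_mul (irreducible_quad _ nsq)).
    exact: coprimep_quad.
  by rewrite -horner_coef0.
(* degrees below (q - 3)/2, a + 16 blocks and order 2 a: the margin of 16 blocks
   over half the order absorbs the growth of the degrees in the conditions *)
have := @stepanov_bound _ f 3 (#|F|.-1./2) ((#|F| - 3)./2) (a + 16) (2 * a)
  sf qE fx0 nsqf.
have -> : [set x | f.[x] ^+ #|F|.-1./2 == 1] = [set x | is_square f.[x]].
  apply/setP => x; rewrite !inE euler_criterion //; case: is_square; rewrite ?eqxx //.
  by rewrite eq_sym -subr_eq0 opprK (negPf two0).
move: #|[set x | _]| => N; move: (#|F|) oddq qE aq => q oddq qE aq.
have aq' : (18 * a <= q)%N.
  by apply: leq_trans aq; rewrite expnS expn1 leq_mul2r a18 orbT.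
move=> bnd; have {}bnd :
    (N * (2 * a) < (q - 3)./2 + 4 * q.-1./2 + (a + 16).-1 * q)%N.
  apply: bnd; [lia | lia | lia |].
  have -> : (2 * (a + 16) * (q - 3)./2 = (a + 16) * (q - 3))%N.
    by have : ((q - 3)./2 * 2 = q - 3)%N by [lia]; nia.
  nia.
have -> : (4 * a * N = 2 * (N * (2 * a)))%N by lia.
have : ((a + 16).-1 * q = a * q + 15 * q)%N by nia.
move: (N * _)%N bnd ((a + 16).-1 * q)%N => m bnd k; lia.
Qed.

(** * Consequences of dynamical irreducibility *)

Lemma irreducible_shift (F : fieldType) (p : {poly F}) (b : F) :
  irreducible_poly p -> irreducible_poly (p \Po ('X + b%:P)).
Proof.
move=> [sp irr]; split; first by rewrite size_comp_poly2 // size_XaddC.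
move=> d sd ddv.
have shiftK (g : {poly F}) : g \Po ('X - b%:P) \Po ('X + b%:P) = g.
  by rewrite -comp_polyA comp_polyB comp_polyX comp_polyC addrK comp_polyXr.
have := dvdp_comp_poly ('X - b%:P) ddv.
rewrite -comp_polyA comp_polyD comp_polyX comp_polyC subrK comp_polyXr => /irr.
rewrite size_comp_poly2 ?size_XsubC // => /(_ sd) /andP[dv1 dv2].
apply/andP; split => //.
by have := dvdp_comp_poly ('X + b%:P) dv2; rewrite shiftK.
Qed.

Lemma comp_quad (F : fieldType) (c t : F) (g : {poly F}) :
  quad c t \Po g = (g - t%:P) ^+ 2 + c%:P.
Proof. by rewrite comp_polyD rmorphXn /= comp_polyB comp_polyX !comp_polyC. Qed.

Lemma dynirr_nonsquare_opp (F : finFieldType) r (f : 'I_r -> {poly F})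
    (b : 'I_r -> F) c :
  (forall j, f j = quad c (b j)) -> dynamically_irreducible f ->
  'I_r -> ~~ is_square (- c).
Proof.
move=> fE dyn i; have := dyn [:: i] isT; rewrite /comp_word /= comp_polyXr fE.
move=> irr; apply/negP => /is_squareP[y yE].
have dv : 'X - (b i + y)%:P %| quad c (b i).
  by rewrite dvdp_XsubCl rootE horner_quad addrAC subrr add0r -yE addNr.
have := irr.2 _ _ dv; rewrite size_XsubC => /(_ isT) /eqp_size.
by rewrite size_XsubC size_quad.
Qed.

(** The octic is f_i o f_j o f_i, translated so as to be even. *)
Lemma dynirr_nonsquare_orbit (F : finFieldType) r (f : 'I_r -> {poly F})
    (b : 'I_r -> F) c :
  odd #|F| -> 2 != 0 :> F ->
  (forall j, f j = quad c (b j)) -> dynamically_irreducible f ->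
  forall i j, ~~ is_square ((((c - b j) ^+ 2 + c) - b i) ^+ 2 + c).
Proof.
move=> oddq two0 fE dyn i j.
have nsq := dynirr_nonsquare_opp fE dyn i.
apply: (irreducible_octic_nonsquare (u := 2 * (c - b j)) oddq two0 nsq).
have := irreducible_shift (b i) (dyn [:: i; j; i] isT).
rewrite /comp_word /= comp_polyXr !fE -!comp_polyA !comp_quad.
by congr irreducible_poly; rewrite -mul_polyC; ring.
Qed.

(** * The second moment and the final estimate *)

(** Both sides estimate 2 a times the sum over x of the squared character sums
    over T; for x in B all the terms of the character sum are -1. *)
Lemma second_moment_bound (F : finFieldType) (c : F) (a : nat) (B T : {set F}) :
  odd #|F| -> 2 != 0 :> F -> ~~ is_square (- c) ->
  (18 <= a)%N -> (a ^ 2 <= #|F|)%N ->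
  (forall t x, t \in T -> x \in B -> ~~ is_square ((x - t) ^+ 2 + c)) ->
  (2 * a * #|B| * #|T| ^ 2 <= 2 * a * #|F| * #|T| + 35 * #|F| * #|T| ^ 2)%N.
Proof.
move=> oddq two0 nsq a18 aq nsqBT.
(* e t is the quadratic character of (x - t)^2 + c, which is never 0 *)
pose u t x := is_square ((quad c t).[x]).
pose e t x : int := (-1) ^+ ~~ u t x.
have sum1 : \sum_(x : F) (1 : int) = #|F|%:Z by rewrite sumr_const natz.
have corr_diag t : \sum_x e t x * e t x = #|F|%:Z.
  rewrite -sum1; apply: eq_bigr => x _.
  by rewrite /e; case: (u t x).
have corr s t : s != t -> (2 * a)%:Z * (\sum_x e s x * e t x) <= 35 * #|F|%:Z.
  move=> st; have bnd := quad_pair_bound oddq two0 nsq st a18 aq.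
  have eE x : e s x * e t x = 2 * (is_square ((quad c s * quad c t).[x]) : nat)%:Z - 1.
    rewrite hornerM is_squareM ?horner_quad_neq0 // /e /u.
    by do 2!case: is_square.
  rewrite (eq_bigr _ (fun x _ => eE x)) sumrB -mulr_sumr sum1.
  have -> : \sum_x (is_square ((quad c s * quad c t).[x]) : nat)%:Z =
      #|[set x | is_square ((quad c s * quad c t).[x])]|%:Z.
    rewrite -sum1_card (big_morph Posz PoszD (erefl _)) [RHS]big_mkcond /=.
    by apply: eq_bigr => x _; rewrite inE; case: is_square.
  move: bnd; set N := #|_|; lia.
have lower : #|B|%:Z * #|T|%:Z ^+ 2 <= \sum_x (\sum_(t in T) e t x) ^+ 2.
  rewrite (bigID (mem B)) /=.
  have -> : \sum_(x in B) (\sum_(t in T) e t x) ^+ 2 = #|B|%:Z * #|T|%:Z ^+ 2.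
    rewrite (eq_bigr (fun=> #|T|%:Z ^+ 2)) => [|x xB].
      by rewrite sumr_const -mulr_natl natz.
    rewrite (eq_bigr (fun=> -1)) => [|t tT].
      by rewrite sumr_const mulNrn natz sqrrN.
    by rewrite /e /u horner_quad (negPf (nsqBT _ _ tT xB)).
  by rewrite lerDl sumr_ge0 // => x _; exact: sqr_ge0.
have upper : (2 * a)%:Z * \sum_x (\sum_(t in T) e t x) ^+ 2 <=
    (2 * a * #|F| * #|T| + 35 * #|F| * #|T| ^ 2)%N%:Z.
  have -> : \sum_x (\sum_(t in T) e t x) ^+ 2 =
      \sum_(s in T) \sum_(t in T) \sum_x e s x * e t x.
    rewrite (eq_bigr _ (fun s _ => exchange_big _ _ _ _ _ _)) /= exchange_big /=.
    apply: eq_bigr => x _; rewrite expr2 mulr_suml.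
    by apply: eq_bigr => s _; rewrite mulr_sumr.
  rewrite mulr_sumr.
  have row s : s \in T -> (2 * a)%:Z * \sum_(t in T) \sum_x e s x * e t x <=
      (2 * a * #|F| + 35 * #|F| * #|T|)%N%:Z.
    move=> sT; rewrite (bigD1 s) //= corr_diag mulrDr.
    have : \sum_(t in T | t != s) (2 * a)%:Z * \sum_x e s x * e t x <=
        \sum_(t in T) 35 * #|F|%:Z.
      rewrite [leRHS](bigD1 s) //= -[leLHS]add0r lerD // ?ler_sum // => t /andP[_ ts].
      by apply: corr; rewrite eq_sym.
    rewrite -mulr_sumr sumr_const -[_ *+ #|T|]mulr_natr !natz.
    by rewrite PoszD (PoszM _ #|T|) (PoszM 35) (PoszM (2 * a)) lerD2l.
  apply: (le_trans (ler_sum _ row)).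
  rewrite sumr_const -[_ *+ #|T|]mulr_natr !natz; nia.
nia.
Qed.

Lemma card_le_double_image (F : finFieldType) (c : F) (B T : {set F}) :
  (forall b, b \in B -> (c - b) ^+ 2 + c \in T) -> (#|B| <= 2 * #|T|)%N.
Proof.
move=> BT; pose sq t : F := odflt 0 [pick y | t - c == y ^+ 2].
have sub : B \subset [set c - sq t | t in T] :|: [set c + sq t | t in T].
  apply/subsetP => b bB; have tT := BT b bB; rewrite in_setU; apply/orP.
  have : (c - b) ^+ 2 == sq ((c - b) ^+ 2 + c) ^+ 2.
    rewrite /sq addrK; case: pickP => [y /= //|/(_ (c - b))]; by rewrite eqxx.
  rewrite eqf_sqr => /orP[]/eqP bE; [left|right]; apply/imsetP;
    exists ((c - b) ^+ 2 + c) => //; first by rewrite -bE; ring.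
  by apply: oppr_inj; rewrite opprD -bE; ring.
apply: leq_trans (subset_leq_card sub) _.
rewrite (leq_trans (leq_card_setU _ _)) // mul2n -addnn.
by apply: leq_add; apply: leq_imset_card.
Qed.

Lemma nat_floor_sqrt (q : nat) : exists a, (a ^ 2 <= q < a.+1 ^ 2)%N.
Proof.
elim: q => [|q [a /andP[aq qa]]]; first by exists 0%N.
have [lt|ge] := ltnP q.+1 (a.+1 ^ 2); first by exists a; rewrite lt (leq_trans aq).
by exists a.+1; rewrite ge /=; lia.
Qed.

(** The values (c - b)^2 + c, for b in B, play the part of T in
    [second_moment_bound]. *)
Lemma dynirr_card_bound (F : finFieldType) (c : F) (B : {set F}) (a : nat) :
  odd #|F| -> 2 != 0 :> F -> ~~ is_square (- c) ->
  (forall x b, x \in B -> b \in B ->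
    ~~ is_square ((((c - b) ^+ 2 + c) - x) ^+ 2 + c)) ->
  (72 <= a)%N -> (a ^ 2 <= #|F| < a.+1 ^ 2)%N -> (#|B| <= 72 * a)%N.
Proof.
move=> oddq two0 nsq nsqB a72 /andP[aq qa].
pose T := [set (c - b) ^+ 2 + c | b in B].
have BT : (#|B| <= 2 * #|T|)%N.
  by apply: (@card_le_double_image _ c) => b bB; apply/imsetP; exists b.
have nsqBT t x : t \in T -> x \in B -> ~~ is_square ((x - t) ^+ 2 + c).
  by move=> /imsetP[b bB ->] xB; rewrite -sqrrN opprB; apply: nsqB.
have := second_moment_bound oddq two0 nsq (leq_trans _ a72) aq nsqBT => /(_ isT).
move: #|B| #|T| #|F| BT aq qa => r n q rn aq qa bnd.
rewrite leqNgt; apply/negP => ra.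
have n0 : (0 < n)%N by lia.
have {}bnd : (2 * a * r * n <= 2 * a * q + 35 * q * n)%N.
  by rewrite -(leq_pmul2r n0); nia.
have q2 : (q <= a * (a + 2))%N by nia.
have {}bnd : (2 * r * n <= 2 * (a * (a + 2)) + 35 * (a + 2) * n)%N.
  have a0 : (0 < a)%N by lia.
  rewrite -(leq_pmul2l a0); nia.
nia.
Qed.

(** The comparison e <= 3, from (1 - 1/6)^6 <= e^-1, bounds logarithms below. *)
Lemma ln_exp3_ge (R : realType) (k : nat) (x : R) : 3 ^+ k <= x -> k%:R <= ln x.
Proof.
move=> x3.
have e3 : expR 1 <= 3 :> R.
  have h := expR_ge1Dx (- 6^-1 : R).
  have e6 : expR (- 6^-1 : R) ^+ 6 = (expR 1)^-1.
    by rewrite -expRM_natr -expRN mulNr mulVf // pnatr_eq0.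
  have e56 : (5 / 6) ^+ 6 <= (expR 1 : R)^-1.
    rewrite -e6; apply: lerXn2r; rewrite ?nnegrE ?expR_ge0 //; lra.
  rewrite -[expR 1]invrK invf_ple ?posrE ?invr_gt0 ?expR_gt0 //.
  by apply: le_trans e56; lra.
rewrite -[k%:R]expRK ler_ln ?posrE ?expR_gt0 //; last first.
  by apply: lt_le_trans x3; rewrite exprn_gt0.
apply: le_trans x3; rewrite -[k%:R]mul1r expRM_natr.
by apply: lerXn2r; rewrite ?nnegrE ?expR_ge0.
Qed.

(** Below 27 the bound r <= q suffices, as sqrt q <= 8; from 27 on
    (log q)^2 >= 9, so that r <= 72 sqrt q suffices. *)
Lemma sqrt_ln_bound (R : realType) (r q : nat) :
  (3 <= q)%N -> (r <= q)%N ->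
  (forall a, (72 <= a)%N -> (a ^ 2 <= q < a.+1 ^ 2)%N -> (r <= 72 * a)%N) ->
  r%:R <= 8 * Num.sqrt (q%:R : R) * ln (q%:R : R) ^+ 2.
Proof.
move=> q3 rq bnd.
pose y : R := Num.sqrt q%:R.
have y0 : 0 <= y by exact: sqrtr_ge0.
have y2 : y ^+ 2 = q%:R by rewrite sqr_sqrtr.
have rqR : r%:R <= q%:R :> R by rewrite ler_nat.
have [q27|q27] := ltnP q 27.
  have L1 : 1 <= ln (q%:R : R).
    by apply: (@ln_exp3_ge R 1); rewrite expr1 ler_nat.
  have y8 : y <= 8.
    rewrite -(@ler_pXn2r _ 2) ?nnegrE // y2 (_ : 8 ^+ 2 = 64%:R) ?ler_nat; last by ring.
    lia.
  apply: (@le_trans _ _ (8 * y * 1)).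
    by rewrite (le_trans rqR) // -y2 mulr1 expr2 ler_wpM2r.
  by rewrite ler_wpM2l ?mulr_ge0 // expr_ge1 // (le_trans ler01).
have L3 : 3 <= ln (q%:R : R).
  by apply: (@ln_exp3_ge R 3); rewrite (_ : 3 ^+ 3 = 27%:R) ?ler_nat //; ring.
have ry : r%:R <= 72 * y.
  have [a /andP[aq qa]] := nat_floor_sqrt q.
  have [a72|a72] := ltnP a 72.
    have y72 : y <= 72.
      rewrite -(@ler_pXn2r _ 2) ?nnegrE // y2.
      rewrite (_ : 72 ^+ 2 = 5184%:R) ?ler_nat; last by ring.
      apply: leq_trans (ltnW qa) _; rewrite -[5184%N]/(72 ^ 2)%N.
      by rewrite leq_exp2r.
    by rewrite (le_trans rqR) // -y2 expr2 ler_wpM2r.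
  have := bnd a a72; rewrite aq qa => /(_ isT) ra.
  have ay : a%:R <= y.
    by rewrite -(@ler_pXn2r _ 2) ?nnegrE // y2 -natrX ler_nat.
  apply: (@le_trans _ _ (72 * a)%:R); first by rewrite ler_nat.
  by rewrite natrM; lra.
apply: (@le_trans _ _ (8 * y * 3 ^+ 2)); first by lra.
rewrite ler_wpM2l ?mulr_ge0 //.
by apply: lerXn2r; rewrite ?nnegrE // (le_trans _ L3).
Qed.

Theorem corollary2 (R : realType) (F : finFieldType) (p : nat)
    (char_F : p \in [pchar F]) (odd_p : odd p)
    (r : nat) (f : 'I_r -> {poly F}) (b c : 'I_r -> F)
    (f_inj : injective f)
    (f_quad : forall j : 'I_r, f j = ('X - (b j)%:P) ^+ 2 + (c j)%:P)
    (f_dyn : dynamically_irreducible f)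
    (c_const : forall i j : 'I_r, c i = c j) :
  r%:R <= 8 * Num.sqrt (#|F|%:R : R) * ln (#|F|%:R : R) ^+ 2.
Proof.
have oddq := odd_pchar_odd_card char_F odd_p.
have two0 := odd_pchar_two_neq0 char_F odd_p.
case: r f b c f_inj f_quad f_dyn c_const => [|r] f b c f_inj f_quad f_dyn c_const.
  by rewrite mulr0n mulr_ge0 ?sqr_ge0 // mulr_ge0 ?sqrtr_ge0.
have fE j : f j = quad (c ord0) (b j) by rewrite f_quad (c_const j ord0).
have b_inj : injective b by move=> i j bij; apply: f_inj; rewrite !fE bij.
pose B := [set b j | j in 'I_r.+1].
have cardB : #|B| = r.+1 by rewrite card_imset // card_ord.
rewrite -cardB; apply: sqrt_ln_bound; last 1 first.
- move=> a; apply: dynirr_card_bound (dynirr_nonsquare_opp fE f_dyn ord0) _ => //.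
  move=> _ _ /imsetP[i _ ->] /imsetP[j _ ->].
  exact: dynirr_nonsquare_orbit oddq two0 fE f_dyn i j.
- by have := finNzRing_gt1 F; move: oddq; move: #|F|; lia.
- exact: max_card.
Qed.
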